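(* Let $q$ be a query with sensitivity $\Delta q$, let $\mu\in\mathbb R$, $\sigma>0$, $0\le a<c\le\infty$, and let the random scale $b$ be such that $1/b$ has the normal distribution $\mathcal N(\mu,\sigma^2)$ truncated to $[a,c]$, with moment generating function $M_{\mathcal N^T}$. Then the R$^2$DP Laplace mechanism $\mathcal M_q(d,b)=q(d)+\mathrm{Lap}(b)$ satisfies $\epsilon_{\mathcal N^T}$-differential privacy, where $$\epsilon_{\mathcal N^T}=\ln\left[\frac{\mu+\frac{\sigma(\phi(\alpha)-\phi(\beta))}{\Phi(\beta)-\Phi(\alpha)}}{\frac{dM_{\mathcal N^T}(t)}{dt}\big|_{t=-\Delta q}}\right],$$ with $\alpha=\frac{a-\mu}{\sigma}$, $\beta=\frac{c-\mu}{\sigma}$, $\phi$ the standard normal density and $\Phi$ the standard normal cumulative distribution function.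
   Context: The truncated normal distribution on $[a,c]$ has density $\frac{\phi((x-\mu)/\sigma)}{\sigma(\Phi(\beta)-\Phi(\alpha))}$ for $a\le x\le c$ and $0$ otherwise. $\mathrm{Lap}(b)$ is the zero-mean Laplace distribution with density $\frac1{2b}e^{-|x|/b}$; the R$^2$DP Laplace mechanism draws the random scale $b$ (independently of the data) and adds $\mathrm{Lap}(b)$ noise to $q(d)$. $\Delta q=\max|q(d)-q(d')|$ over datasets differing in one individual's data. $\epsilon$-differential privacy: $\mathbb P(\mathcal M(d)\in S)\le e^\epsilon\mathbb P(\mathcal M(d')\in S)$ for all such $d,d'$ and measurable $S$. *)

(* Defs.v *)
From HB Require Import structures.
From mathcomp Require Import all_boot all_order all_algebra.
From mathcomp Require Import all_classical all_reals all_analysis.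
Set Implicit Arguments. Unset Strict Implicit. Unset Printing Implicit Defensive.
Import Order.TTheory GRing.Theory Num.Theory.
Import numFieldNormedType.Exports.
Local Open Scope classical_set_scope.
Local Open Scope ring_scope.

Section defs.
Context {R : realType}.

Definition std_phi (x : R) : R := normal_pdf 0 1 x.
Definition std_Phi (x : R) : R := Rintegral lebesgue_measure `]-oo, x] std_phi.

(* extensions to the extended reals (needed when c = +oo, i.e. beta = +oo) *)
Definition std_phiE (x : \bar R) : R :=
  match x with EFin r => std_phi r | _ => 0 end.
Definition std_PhiE (x : \bar R) : R :=
  match x with EFin r => std_Phi r | +oo%E => 1 | -oo%E => 0 end.

Definition tn_alpha (mu sigma a : R) : R := (a - mu) / sigma.
Definition tn_beta (mu sigma : R) (c : \bar R) : \bar R :=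
  ((c - mu%:E) * (sigma^-1)%:E)%E.

Definition tn_support (a : R) (c : \bar R) : set R :=
  [set x | a <= x /\ (x%:E <= c)%E].

Definition tn_pdf (mu sigma a : R) (c : \bar R) (x : R) : R :=
  \1_(tn_support a c) x *
  (std_phi ((x - mu) / sigma) /
    (sigma * (std_PhiE (tn_beta mu sigma c) - std_Phi (tn_alpha mu sigma a)))).

Definition tn_mgf (mu sigma a : R) (c : \bar R) (t : R) : R :=
  Rintegral lebesgue_measure setT (fun l => expR (t * l) * tn_pdf mu sigma a c l).

Definition lap_pdf (b x : R) : R := (2 * b)^-1 * expR (- `|x| / b).

Definition lap_prob (b y : R) (S : set R) : \bar R :=
  (\int[lebesgue_measure]_(x in S) (lap_pdf b (x - y))%:E)%E.

(* law of the R^2DP Laplace mechanism output y + Lap(b), where the scale b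
   is random with 1/b ~ truncated normal: integrate over l = 1/b. *)
Definition r2dp_lap_prob (mu sigma a : R) (c : \bar R) (y : R) (S : set R) : \bar R :=
  (\int[lebesgue_measure]_(l in setT)
      ((tn_pdf mu sigma a c l)%:E * lap_prob (l^-1) y S))%E.

End defs.

(* datasets are maps from individuals to records; neighbours differ in
   (at most) one individual's data *)
Definition neighbors (I X : Type) (d d' : I -> X) : Prop :=
  exists i : I, forall j : I, j <> i -> d j = d' j.

Definition sensitivity {R : realType} (I X : Type) (q : (I -> X) -> R) (dq : R) : Prop :=
  (forall d d', neighbors d d' -> `|q d - q d'| <= dq) /\
  (forall e, (forall d d', neighbors d d' -> `|q d - q d'| <= e) -> dq <= e).

Definition diff_private {R : realType} (I X : Type) (eps : R)
    (M : (I -> X) -> set R -> \bar R) : Prop :=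
  forall d d', neighbors d d' ->
  forall S : set R, measurable S -> (M d S <= (expR eps)%:E * M d' S)%E.

(* Main.v *)
Require Import Defs.
From HB Require Import structures.
From mathcomp Require Import all_boot all_order all_algebra.
From mathcomp Require Import all_classical all_reals all_analysis.
From mathcomp Require Import measurable_realfun ring lra.
Import Order.TTheory GRing.Theory Num.Theory.
Import numFieldNormedType.Exports.
Local Open Scope classical_set_scope.
Local Open Scope ring_scope.

(* Given b = 1/l, the output density at x is (l/2) exp(-l|x - y|), so by Tonelli
   the mechanism has density g(|x - y|)/2 at x, with
   g(s) = E[l exp(-l s)] = M'(-s), called [tn_decay] below.
   As exp(-l s) and exp(-l u) are both nonincreasing in l, Chebyshev's
   association inequality under the weight l gives
   g(s) g(u) <= g(0) g(s + u).  Since g is nonincreasing and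
   |x - y'| <= |x - y| + dq, the ratio of the two output densities is at most
   g(0)/g(dq), and g(0) is the mean of the truncated normal. *)

(** * The standard normal density and distribution function *)

Section standard_normal.
Context {R : realType}.
Implicit Types x y : R.

Lemma std_phiE_expR x : std_phi x = normal_peak 1 * expR (- x ^+ 2 / 2).
Proof.
by rewrite /std_phi normal_pdfE ?oner_neq0// /normal_fun subr0 expr1n.
Qed.

Lemma std_phi_gt0 x : 0 < std_phi x.
Proof. by rewrite std_phiE_expR mulr_gt0 ?expR_gt0// normal_peak_gt0. Qed.

Lemma continuous_std_phi : continuous (@std_phi R).
Proof. exact: continuous_normal_pdf. Qed.

Lemma is_derive_std_phi x : is_derive x 1 (@std_phi R) (- x * std_phi x).
Proof.
have -> : @std_phi R = normal_peak 1 \*: (expR \o (fun x => - x ^+ 2 / 2)).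
  by apply/funext => y; rewrite std_phiE_expR.
apply: is_derive_eq => //.
rewrite /= /GRing.scale /=.
by field.
Qed.

Lemma is_derive_std_Phi x : is_derive x 1 (@std_Phi R) (std_phi x).
Proof.
have x1 : x < x + 1 by rewrite ltrDl.
have [//|dPhi] := continuous_FTC1 (a := -oo%O) x1
    (integrableS measurableT _ (@subsetT _ _) (integrable_normal_pdf 0 1)) (ltNyr _)
    (continuous_std_phi x).
by rewrite derive1E -/(std_phi x) => <-; exact: derivableP.
Qed.

(** The identity as a random variable of law N(0,1), so that the general bound and limit of [cdf]
    carry over to [std_Phi]. *)
Let std_normal_id : {RV @normal_prob R 0 1 >-> R}.
Proof.
refine (@mfun_Sub _ default_measure_display (measurableTypeR R) R id (mem_set _)).
exact: measurable_id.
Defined.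

Lemma std_Phi_cdf x : (std_Phi x)%:E = cdf std_normal_id x.
Proof.
rewrite /std_Phi /Rintegral fineK//.
apply: integrable_fin_num => //.
by apply: integrableS (integrable_normal_pdf 0 1).
Qed.

Lemma std_Phi_le1 x : std_Phi x <= 1.
Proof. by rewrite -lee_fin std_Phi_cdf; exact: cdf_le1. Qed.

Lemma std_Phi_cvg1 : @std_Phi R x @[x --> +oo] --> (1 : R).
Proof.
apply: fine_cvg.
exact: (cvg_cdfy1 std_normal_id).
Qed.

Lemma std_phi_cvg0 : @std_phi R x @[x --> +oo] --> (0 : R).
Proof.
(* Expanding (x - 1)^2 >= 0 gives - x^2 / 2 <= 1/2 - x, so the Gaussian is dominated by a multiple
   of [expR (- x)]. *)
apply: (@squeeze_cvgr _ _ _ _ (cst 0)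
  (fun x => normal_peak 1 * expR (2^-1) * expR (- x))).
- near=> x; rewrite ltW ?std_phi_gt0//= std_phiE_expR -mulrA ler_wpM2l//.
    by rewrite normal_peak_ge0.
  rewrite -expRD ler_expR; have := sqr_ge0 (x - 1); lra.
- exact: cvg_cst.
- rewrite -[X in _ --> X](mulr0 (normal_peak 1 * expR 2^-1)).
  by apply: cvgM; [exact: cvg_cst|exact: cvgr_expR].
Unshelve. all: by end_near. Qed.

Lemma std_Phi_lt x y : x < y -> std_Phi x < std_Phi y.
Proof.
move=> xy; rewrite -subr_gt0.
have [|z _ ->] := MVT xy (fun z _ => is_derive_std_Phi z).
  by apply: derivable_within_continuous => z _; have [] := is_derive_std_Phi z.
by rewrite mulr_gt0 ?std_phi_gt0// subr_gt0.
Qed.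

End standard_normal.

(** * Association inequality for weighted exponential moments *)

Section exponential_moments.
Context d (T : measurableType d) (R : realType) (m : {measure set T -> \bar R}).
Variables w h : T -> R.
Hypothesis w0 : forall x, 0 <= w x.

Let G s := \int[m]_x (w x * expR (- s * h x)).

Hypothesis intG : forall s : R, 0 <= s ->
  m.-integrable setT (fun x => (w x * expR (- s * h x))%:E).

(** The exponential factor is positive, so a vanishing moment forces [w] to be zero almost
    everywhere, a condition independent of the exponent. This disposes of the cases where a ratio of
    moments would divide by zero. *)
Lemma exp_moment_eq0 (s u : R) : 0 <= s -> 0 <= u -> G s = 0 -> G u = 0.
Proof.
move=> s0 u0 Gs0.
have mf v v0 := measurable_int m (intG v v0).
have Es0 : (\int[m]_x `|(w x * expR (- s * h x))%:E|)%E = 0%E.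
  under eq_integral do rewrite gee0_abs ?lee_fin ?mulr_ge0 ?expR_ge0//.
  by rewrite -[LHS]fineK ?integrable_fin_num ?intG//; congr EFin.
have /(ae_eq_integral_abs m measurableT (mf _ s0)) w_ae0 := Es0.
rewrite /G /Rintegral (@ae_eq_integral _ _ _ m setT (cst 0%E)) ?integral0//.
  exact: mf.
apply: filterS w_ae0 => x /(_ I) [] /eqP.
by rewrite mulf_eq0 (gt_eqF (expR_gt0 _)) orbF => /eqP -> _; rewrite mul0r.
Qed.

(* If [k] is the value of [h] at which [expR (- u * h)] equals its [w]-weighted
   mean, then [(expR (- s * h) - expR (- s * k)) * (expR (- u * h) - expR (- u * k))]
   is nonnegative, and integrating it against [w] gives the claim. *)
Lemma exp_moment_association (s u : R) : 0 <= s -> 0 <= u -> G s * G u <= G 0 * G (s + u).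
Proof.
move=> s0 u0.
have G0 v : 0 <= G v by apply: Rintegral_ge0 => x _; rewrite mulr_ge0 ?expR_ge0.
have [->|u_neq0] := eqVneq u 0; first by rewrite addr0 mulrC.
have [->|Gu_neq0] := eqVneq (G u) 0; first by rewrite mulr0 mulr_ge0.
have su0 : 0 <= s + u by exact: addr_ge0.
have Gu0 : 0 < G u by rewrite lt0r Gu_neq0 G0.
have G00 : 0 < G 0.
  rewrite lt0r G0 andbT; apply: contra_neq Gu_neq0; exact: exp_moment_eq0.
pose k := - ln (G u / G 0) / u.
have ek : expR (- u * k) = G u / G 0.
  rewrite /k mulrA mulrNN mulrAC divff// mul1r lnK//.
  by rewrite posrE divr_gt0.
clearbody k.
have : 0 <= \int[m]_x (w x * (expR (- s * h x) - expR (- s * k)) *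
                             (expR (- u * h x) - expR (- u * k))).
  apply: Rintegral_ge0 => x _; rewrite -mulrA mulr_ge0//.
  have [hk|kh] := leP (h x) k.
    rewrite mulr_ge0// subr_ge0 ler_expR !mulNr lerN2 ler_wpM2l//.
  rewrite mulr_le0// subr_le0 ler_expR !mulNr lerN2 ler_wpM2l//; exact: ltW.
(* The expansion is grouped so that the last bracket is zero by the choice of [k]; what remains is
   the claim divided by [G 0]. *)
rewrite (_ : Rintegral _ _ _ = G (s + u) - expR (- u * k) * G s
    - expR (- s * k) * (G u - expR (- u * k) * G 0)).
  rewrite ek divfK ?gt_eqF// subrr mulr0 subr0 subr_ge0 mulrAC ler_pdivrMr//.
  by rewrite mulrC [leRHS]mulrC.
have intZ k' v : 0 <= v ->
    m.-integrable setT (fun x => (k' * (w x * expR (- v * h x)))%:E).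
  by move=> v0; exact: (integrableZl measurableT k' (intG v v0)).
rewrite mulrBr (mulrA (expR _) (expR _)) -!RintegralZl//; [|exact: intG..].
rewrite -!RintegralB//; [| | |exact: intZ|exact: intZ|exact: intG|exact: intZ].
- apply: eq_Rintegral => x _; rewrite oppr0 mul0r expR0 opprD mulrDl expRD; ring.
- rewrite /comp; under eq_fun do rewrite EFinB.
  by apply: integrableB => //; [exact: intG|exact: intZ].
- rewrite /comp; under eq_fun do rewrite EFinB.
  by apply: integrableB => //; exact: intZ.
Qed.

End exponential_moments.

(** * The truncated normal law: integrability, derivative of the generating function, mean *)

Section truncated_normal.
Context {R : realType}.
Variables (mu sigma a : R) (c : \bar R).
Hypotheses (sigma_gt0 : 0 < sigma) (a_ge0 : 0 <= a) (ac : (a%:E < c)%E).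

Let z (l : R) := (l - mu) / sigma.
Let beta := tn_beta mu sigma c.
Let alpha := tn_alpha mu sigma a.
Let pdf := tn_pdf mu sigma a c.

Lemma tn_mass_gt0 : 0 < std_PhiE beta - std_Phi alpha.
Proof.
rewrite subr_gt0 /beta; case: c ac => [r| |//]; rewrite ?lte_fin => ar.
  by apply: std_Phi_lt; rewrite /alpha /tn_alpha ltr_pM2r ?invr_gt0// ltrD2r.
rewrite /tn_beta gt0_mulye ?lte_fin ?invr_gt0//=.
(* Passing through [alpha + 1] keeps the comparison with the limit value 1 strict. *)
by apply: lt_le_trans (std_Phi_le1 (alpha + 1)); apply: std_Phi_lt; rewrite ltrDl.
Qed.

Let K := (sigma * (std_PhiE beta - std_Phi alpha))^-1.

Let K_gt0 : 0 < K.
Proof. by rewrite invr_gt0 mulr_gt0// tn_mass_gt0. Qed.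

Lemma tn_supportE :
  tn_support a c = [set` if c is EFin r then `[a, r] else `[a, +oo[].
Proof.
apply/seteqP; split=> x; case: c ac => [r| |]//= _; rewrite /tn_support /= in_itv/=.
- by move=> [-> ]; rewrite lee_fin.
- by move=> [->].
- by move=> /andP[-> ?]; rewrite lee_fin.
- by rewrite andbT => ->; rewrite leey.
Qed.

Lemma measurable_tn_support : measurable (tn_support a c).
Proof. by rewrite tn_supportE; case: c => [r| |]. Qed.

Lemma tn_pdf_ge0 l : 0 <= tn_pdf mu sigma a c l.
Proof. by rewrite mulr_ge0// mulr_ge0 ?ltW// ?std_phi_gt0. Qed.

Lemma tn_pdf_lt0 l : l < 0 -> tn_pdf mu sigma a c l = 0.
Proof.
move=> l0; rewrite /tn_pdf indicE memNset ?mul0r// => -[al _].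
by have := le_lt_trans (le_trans a_ge0 al) l0; rewrite ltxx.
Qed.

Lemma measurable_tn_pdf : measurable_fun setT (tn_pdf mu sigma a c).
Proof.
apply: measurable_funM; first by apply: measurable_indic; exact: measurable_tn_support.
apply: measurable_funM => //.
apply: measurableT_comp; first exact: measurable_normal_pdf.
apply: measurable_funM => //; exact: measurable_funB.
Qed.

(* completing the square *)
Lemma expR_std_phi t l : expR (t * l) * std_phi (z l) =
  normal_peak 1 / normal_peak sigma * expR (mu * t + sigma ^+ 2 * t ^+ 2 / 2) *
  normal_pdf (mu + sigma ^+ 2 * t) sigma l.
Proof.
have s0 : sigma != 0 by rewrite gt_eqF.
have p0 : normal_peak sigma != 0 by rewrite gt_eqF// normal_peak_gt0.
rewrite std_phiE_expR normal_pdfE// /normal_fun.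
rewrite mulrCA -!mulrA; congr *%R.
rewrite mulrCA (mulrA (_^-1)) mulVf// mul1r -!expRD; congr expR.
by rewrite /z; field.
Qed.

(** Exponential tilting turns the Gaussian into a multiple [C] of a Gaussian with shifted mean, and
    truncation only decreases it. *)
Lemma integrable_expR_tn_pdf t :
  lebesgue_measure.-integrable setT (fun l => (expR (t * l) * pdf l)%:E).
Proof.
pose C := K * (normal_peak 1 / normal_peak sigma *
  expR (mu * t + sigma ^+ 2 * t ^+ 2 / 2)).
have := integrableZl measurableT C
  (integrable_normal_pdf (mu + sigma ^+ 2 * t) sigma).
apply: le_integrable => //.
  apply/measurable_EFinP/measurable_funM; last exact: measurable_tn_pdf.
  by apply: measurableT_comp => //; exact: measurable_funM.
move=> l _.
have C0 : 0 <= C.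
  rewrite /C !mulr_ge0 ?expR_ge0 ?normal_peak_ge0 ?(ltW K_gt0)//.
  by rewrite invr_ge0 normal_peak_ge0.
rewrite -EFinM lee_fin (ger0_norm (mulr_ge0 (expR_ge0 _) (tn_pdf_ge0 _))).
rewrite (ger0_norm (mulr_ge0 C0 (normal_pdf_ge0 _ _ _))).
have -> : C * normal_pdf (mu + sigma ^+ 2 * t) sigma l =
    K * (expR (t * l) * std_phi (z l)) by rewrite expR_std_phi mulrA.
rewrite /pdf /tn_pdf -/K -/(z l) (mulrC _ K) (mulrCA _ K) (mulrCA _ K).
rewrite ler_wpM2l ?(ltW K_gt0)// ler_wpM2l ?expR_ge0//.
by rewrite ler_piMl ?(ltW (std_phi_gt0 _)).
Qed.

(** The size-biased density: its total mass is the mean of the law. It is nonnegative because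
    [0 <= a] keeps the support away from negative [l]. *)
Let w (l : R) := l * pdf l.

Lemma tn_w_ge0 l : 0 <= w l.
Proof.
have [l0|/tn_pdf_lt0 l0] := leP 0 l; first by rewrite mulr_ge0// tn_pdf_ge0.
by rewrite /w /pdf l0 mulr0.
Qed.

(** Absorbs the factor [l] into an exponential, so that moments of [w] at [t] are controlled by
    those of the density at [t + 1]. *)
Lemma tn_w_le_expR l : w l <= expR l * pdf l.
Proof.
rewrite ler_wpM2r ?tn_pdf_ge0//; apply: le_trans (expR_ge1Dx l).
by rewrite lerDr.
Qed.

Lemma integrable_tn_w t :
  lebesgue_measure.-integrable setT (fun l => (w l * expR (t * l))%:E).
Proof.
have := integrable_expR_tn_pdf (t + 1).
apply: le_integrable => //.
  apply/measurable_EFinP/measurable_funM.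
    by apply: measurable_funM => //; exact: measurable_tn_pdf.
  by apply: measurableT_comp => //; exact: measurable_funM.
move=> l _; rewrite lee_fin (ger0_norm (mulr_ge0 (tn_w_ge0 _) (expR_ge0 _))).
rewrite (ger0_norm (mulr_ge0 (expR_ge0 _) (tn_pdf_ge0 _))).
rewrite (mulrDl t) mul1r expRD -(mulrA (expR (t * l))) (mulrC (w l)).
by apply: ler_wpM2l; [exact: expR_ge0|exact: tn_w_le_expR].
Qed.

(** Differentiation under the integral on ]t - 1, t + 1[. There the partial derivative is dominated
    by its value at [t + 1], since [w] vanishes for negative [l]. *)
Lemma derive1_tn_mgf t :
  derive1 (tn_mgf mu sigma a c) t = \int[lebesgue_measure]_l (w l * expR (t * l)).
Proof.
have d1 (x l : R) : is_derive x 1 (fun u => expR (u * l) * pdf l) (w l * expR (x * l)).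
  apply: is_derive_eq => //.
  rewrite /= /GRing.scale /= /w; ring.
rewrite /tn_mgf.
rewrite (@differentiation_under_integral _ _ _ lebesgue_measure
   (fun u l => expR (u * l) * pdf l) setT measurableT t (t - 1) (t + 1) _ _ _
   (fun l => w l * expR ((t + 1) * l))) => //.
- apply: eq_Rintegral => l _; rewrite /partial1of2 derive1E.
  by have [_ ->] := d1 t l.
- by rewrite /= in_itv/= gtrDl ltrDl ltrN10 ltr01.
- by move=> x _; exact: integrable_expR_tn_pdf.
- by move=> l; exact: mulr_ge0 (tn_w_ge0 _) (expR_ge0 _).
- exact: integrable_tn_w.
move=> x l /=; rewrite in_itv/= => /andP[_ xt] _.
rewrite /partial1of2 derive1E; have [_ ->] := d1 x l.
rewrite (ger0_norm (mulr_ge0 (tn_w_ge0 _) (expR_ge0 _))).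
have [l0|/tn_pdf_lt0 l0] := leP 0 l; last by rewrite /w /pdf l0 mulr0 !mul0r.
by rewrite ler_wpM2l ?tn_w_ge0// ler_expR ler_wpM2r// ltW.
Qed.

(** An antiderivative of [l * std_phi (z l)], found by writing l = mu + sigma z and using that z
    phi(z) is the derivative of - phi(z). *)
Let F (l : R) := sigma * mu * std_Phi (z l) - sigma ^+ 2 * std_phi (z l).

Let dF (l : R) : is_derive l 1 F (l * std_phi (z l)).
Proof.
have dz : is_derive l 1 z (sigma^-1).
  apply: is_derive_eq => //.
  by rewrite /= /GRing.scale /=; ring.
have dphi := is_derive1_comp (is_derive_std_phi (z l)) dz.
have dPhi := is_derive1_comp (is_derive_std_Phi (z l)) dz.
rewrite (_ : F = (sigma * mu) \*: (std_Phi \o z) - (sigma ^+ 2) \*: (std_phi \o z))//.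
apply: is_derive_eq => //.
rewrite /= /GRing.scale /= /z; field.
by rewrite gt_eqF.
Qed.

Let cont_F : continuous F.
Proof.
by move=> l; apply: differentiable_continuous; apply/derivable1_diffP; have [] := dF l.
Qed.

Let cont_dF : continuous (fun l : R => l * std_phi (z l)).
Proof.
move=> l; apply: cvgM; first exact: cvg_id.
apply: (@continuous_comp _ _ _ z std_phi); last exact: continuous_std_phi.
by apply: cvgM; [apply: cvgB; [exact: cvg_id|exact: cvg_cst]|exact: cvg_cst].
Qed.

Let cvg_F : F l @[l --> +oo] --> sigma * mu.
Proof.
have zoo : z l @[l --> +oo] --> +oo.
  by apply: gt0_cvgMly; [rewrite invr_gt0|exact: cvg_addrr].
rewrite -[X in _ --> X](_ : sigma * mu * 1 - sigma ^+ 2 * 0 = _); last by ring.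
apply: cvgB; (apply: cvgM; first exact: cvg_cst).
  exact: (cvg_comp _ _ zoo std_Phi_cvg1).
exact: (cvg_comp _ _ zoo std_phi_cvg0).
Qed.

Lemma tn_mean : \int[lebesgue_measure]_l (w l) =
  mu + sigma * (std_phi alpha - std_phiE beta) / (std_PhiE beta - std_Phi alpha).
Proof.
have F'E : F^`()%classic = fun l => l * std_phi (z l).
  by apply/funext => l; rewrite derive1E; have [_ ->] := dF l.
have D0 : std_PhiE beta - std_Phi alpha != 0 by rewrite gt_eqF// tn_mass_gt0.
(* The closed form is the normalising constant [K] times the increment of [F] over the support. Its
   upper boundary value is written with [std_PhiE] and [std_phiE] to cover finite and infinite [c]
   at once. *)
have -> : mu + sigma * (std_phi alpha - std_phiE beta) / (std_PhiE beta - std_Phi alpha) =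
    K * (sigma * mu * std_PhiE beta - sigma ^+ 2 * std_phiE beta - F a).
  rewrite /F /K -/(tn_alpha mu sigma a) -/alpha; field.
  by rewrite D0 gt_eqF.
rewrite /Rintegral.
have -> : (\int[lebesgue_measure]_l (w l)%:E =
    K%:E * \int[lebesgue_measure]_(l in tn_support a c) (l * std_phi (z l))%:E)%E.
  rewrite [in RHS]integral_mkcond -ge0_integralZl//=.
  - apply: eq_integral => l _; rewrite patchE /w /pdf /tn_pdf -/K indicE.
    case: ifP => _; rewrite ?mul0r ?mulr0 ?mule0//.
    rewrite -EFinM mul1r; congr EFin; rewrite /K/z; ring.
  - apply/(measurable_restrictT _ _).1; first exact: measurable_tn_support.
    apply/measurable_EFinP/measurable_funTS; exact: continuous_measurable_fun.
  - move=> l _; rewrite patchE; case: ifPn => // /set_mem[al _].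
    by rewrite lee_fin mulr_ge0 ?normal_pdf_ge0// (le_trans a_ge0).
  - by rewrite lee_fin ltW.
rewrite tn_supportE /beta; case: c ac => [r| |//]; rewrite ?lte_fin => ar.
  rewrite (continuous_FTC2 (F := F) ar).
  - by rewrite -EFinB -EFinM.
  - exact: continuous_subspaceT.
  - split.
    + by move=> l _; have [] := dF l.
    + by apply: cvg_at_right_filter; exact: cont_F.
    + by apply: cvg_at_left_filter; exact: cont_F.
  - by move=> l _; rewrite F'E.
(* For infinite [c] the upper boundary value is the limit of [F] at infinity. *)
rewrite (ge0_continuous_FTC2y (F := F) (l := sigma * mu)).
- rewrite -EFinB -EFinM /tn_beta gt0_mulye ?lte_fin ?invr_gt0//=.
  by rewrite mulr1 mulr0 subr0.
- by move=> l al; rewrite mulr_ge0 ?normal_pdf_ge0// (le_trans a_ge0).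
- exact: continuous_subspaceT.
- exact: cvg_F.
- by move=> l _; have [] := dF l.
- by apply: cvg_at_right_filter; exact: cont_F.
- by move=> l _; rewrite F'E.
Qed.

End truncated_normal.

(** * The output law of the mechanism and its privacy bound *)

Section r2dp_laplace.
Context {R : realType}.
Variables (mu sigma a : R) (c : \bar R).
Hypotheses (sigma_gt0 : 0 < sigma) (a_ge0 : 0 <= a) (ac : (a%:E < c)%E).

Let w (l : R) := l * tn_pdf mu sigma a c l.

Definition tn_decay (s : R) : R := \int[lebesgue_measure]_l (w l * expR (- s * l)).

Let w_ge0 l : 0 <= w l. Proof. exact: tn_w_ge0. Qed.

Let int_w s : lebesgue_measure.-integrable setT (fun l => (w l * expR (- s * l))%:E).
Proof. exact: integrable_tn_w. Qed.

Lemma tn_decay_ge0 s : 0 <= tn_decay s.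
Proof. by apply: Rintegral_ge0 => l _; rewrite mulr_ge0 ?expR_ge0. Qed.

Lemma tn_decay_le s t : s <= t -> tn_decay t <= tn_decay s.
Proof.
move=> st; apply: le_Rintegral => //; [exact: int_w|exact: int_w|] => l _.
have [l0|/(tn_pdf_lt0 _ _ _ _ a_ge0) l0] := leP 0 l; last by rewrite /w l0 mulr0 !mul0r.
by rewrite ler_wpM2l// ler_expR ler_wpM2r// lerN2.
Qed.

(* Also valid at [l = 0], where [l^-1 = 0] and both sides vanish. *)
Lemma tn_pdf_lap_pdf l u :
  tn_pdf mu sigma a c l * lap_pdf l^-1 u = 2^-1 * (w l * expR (- `|u| * l)).
Proof.
by rewrite /w /lap_pdf invfM !invrK; ring.
Qed.

(** The joint density of the inverse scale and the output, cut off by the indicator of [S] so that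
    Tonelli applies on the whole product space. *)
Let kernel (y : R) (S : set R) (p : measurableTypeR R * measurableTypeR R) : \bar R :=
  (2^-1 * (w p.1 * expR (- `|p.2 - y| * p.1)) * \1_S p.2)%:E.

Let kernel_ge0 y S p : (0 <= kernel y S p)%E.
Proof.
by rewrite lee_fin mulr_ge0// mulr_ge0// mulr_ge0 ?expR_ge0.
Qed.

Let measurable_kernel y S : measurable S -> measurable_fun setT (kernel y S).
Proof.
move=> mS; apply/measurable_EFinP; apply: measurable_funM; last first.
  by apply: (measurableT_comp (measurable_indic mS)); exact: measurable_snd.
apply: measurable_funM => //; apply: measurable_funM.
  apply: (@measurableT_comp _ _ _ _ _ _ w); last exact: measurable_fst.
  by apply: measurable_funM => //; exact: measurable_tn_pdf.
apply: measurableT_comp => //; apply: measurable_funM; last exact: measurable_fst.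
apply: measurableT_comp => //; apply: measurableT_comp => //.
by apply: measurable_funB => //; exact: measurable_snd.
Qed.

Lemma r2dp_lap_probE y S : measurable S ->
  (r2dp_lap_prob mu sigma a c y S =
   \int[lebesgue_measure]_(x in S) (2^-1 * tn_decay `|x - y|)%:E)%E.
Proof.
move=> mS; rewrite /r2dp_lap_prob.
transitivity (\int[lebesgue_measure]_l \int[lebesgue_measure]_x kernel y S (l, x))%E.
  apply: eq_integral => l _.
  (* For negative [l] the expression [lap_pdf l^-1] is negative, so this case is settled first by
     the vanishing of the truncated density. *)
  have [l0|/(tn_pdf_lt0 _ _ _ _ a_ge0) l0] := leP 0 l; last first.
    rewrite l0 mul0e; apply/esym/integral0_eq => x _.
    by rewrite /kernel /w /= l0 mulr0 mul0r mulr0 mul0r.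
  rewrite /lap_prob integral_mkcond.
  rewrite -ge0_integralZl//=.
  - apply: eq_integral => x _; rewrite /kernel patchE indicE/=.
    by case: ifP => _; rewrite ?mule0 ?mulr0// mulr1 -tn_pdf_lap_pdf.
  - apply/(measurable_restrictT _ _).1 => //; apply: measurable_funTS.
    apply/measurable_EFinP/measurable_funM => //; apply: measurableT_comp => //.
    apply: measurable_funM => //; apply: measurableT_comp => //.
    by apply: measurableT_comp => //; exact: measurable_funB.
  - move=> x _; rewrite erestrict_ge0// => u _.
    by rewrite lee_fin mulr_ge0 ?expR_ge0// invr_ge0 mulr_ge0// invr_ge0.
  - by rewrite lee_fin tn_pdf_ge0.
rewrite fubini_tonelli//; last exact: measurable_kernel.
rewrite [RHS]integral_mkcond; apply: eq_integral => x _.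
rewrite patchE /kernel /= indicE; case: ifP => _.
  under eq_integral do rewrite mulr1.
  under eq_integral do rewrite EFinM.
  rewrite (integralZl measurableT (int_w _)) EFinM /tn_decay /Rintegral fineK//.
  exact: integrable_fin_num (int_w _).
by apply: integral0_eq => l _; rewrite mulr0.
Qed.

Lemma r2dp_lap_prob_le (dq y y' : R) S : measurable S -> `|y - y'| <= dq ->
  (r2dp_lap_prob mu sigma a c y S <=
   (expR (ln (tn_decay 0 / tn_decay dq)))%:E * r2dp_lap_prob mu sigma a c y' S)%E.
Proof.
move=> mS yy'; have dq0 : 0 <= dq by exact: le_trans yy'.
have mdecay u : measurable_fun S (fun x => (2^-1 * tn_decay `|x - u|)%:E).
  apply: measurable_funTS; apply/measurable_EFinP; apply: measurable_funM => //.
  apply: (@measurableT_comp _ _ _ _ _ _ tn_decay).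
    by apply: nonincreasing_measurable => // s t; exact: tn_decay_le.
  by apply: measurableT_comp => //; exact: measurable_funB.
rewrite !r2dp_lap_probE//.
rewrite -ge0_integralZl//; [|exact: mdecay|]; last first.
  by move=> x _; rewrite lee_fin mulr_ge0 ?tn_decay_ge0.
apply: ge0_le_integral => //.
- by move=> x _; rewrite lee_fin mulr_ge0 ?tn_decay_ge0.
- exact: mdecay.
- by apply: measurable_funeM; exact: mdecay.
move=> x _; rewrite -EFinM lee_fin mulrCA ler_wpM2l//.
have eq0 s u : 0 <= s -> 0 <= u -> tn_decay s = 0 -> tn_decay u = 0.
  by move=> s0 u0; apply: exp_moment_eq0.
(* If the denominator vanishes, so does [tn_decay] at every nonnegative point, and the left side is
   zero. *)
have [d0|d_neq0] := eqVneq (tn_decay dq) 0.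
  by rewrite (eq0 _ `|x - y| dq0)// mulr_ge0 ?expR_ge0 ?tn_decay_ge0.
have d_gt0 : 0 < tn_decay dq by rewrite lt0r d_neq0 tn_decay_ge0.
have d0_gt0 : 0 < tn_decay 0 by apply: lt_le_trans d_gt0 _; exact: tn_decay_le.
rewrite lnK ?posrE ?divr_gt0// mulrAC ler_pdivlMr//.
(* Association bounds the product by this middle term; monotonicity and the triangle inequality
   through [y] then replace [|x - y| + dq] by [|x - y'|]. *)
apply: (@le_trans _ _ (tn_decay 0 * tn_decay (`|x - y| + dq))).
  by apply: exp_moment_association.
rewrite ler_wpM2l ?tn_decay_ge0// tn_decay_le//.
rewrite (le_trans _ (lerD (lexx _) yy'))//.
by rewrite (le_trans _ (ler_normD _ _))// addrA subrK.
Qed.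

End r2dp_laplace.

Theorem theoremB5 (R : realType) (I X : Type) (q : (I -> X) -> R)
    (dq mu sigma a : R) (c : \bar R) :
  sensitivity q dq -> 0 < sigma -> 0 <= a -> (a%:E < c)%E ->
  diff_private
    (ln ((mu + sigma * (std_phi (tn_alpha mu sigma a) - std_phiE (tn_beta mu sigma c))
                 / (std_PhiE (tn_beta mu sigma c) - std_Phi (tn_alpha mu sigma a)))
         / derive1 (tn_mgf mu sigma a c) (- dq)))
    (fun d S => r2dp_lap_prob mu sigma a c (q d) S).
Proof.
move=> [q_dq _] sigma_gt0 a_ge0 ac d d' dd' S mS.
(* The derivative at [- dq] unfolds to [tn_decay dq], and the closed form becomes the mean, which is
   [tn_decay 0]. *)
rewrite derive1_tn_mgf// -tn_mean//.
have <- : tn_decay mu sigma a c 0 =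
    \int[lebesgue_measure]_l (l * tn_pdf mu sigma a c l).
  by apply: eq_Rintegral => l _; rewrite oppr0 mul0r expR0 mulr1.
by apply: r2dp_lap_prob_le => //; exact: q_dq.
Qed.
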